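(* For a finite simple graph $G$ the following statements are equivalent: (1) $G$ admits a $\{{}^rP_3, {}^bP_3, {}^bK_3, {}^{rrb}K_3, {}^{rbb}K_3\}$-free $2$-edge-colouring. (2) $G$ admits a $\{{}^rP_3, {}^bP_3, {}^rK_3, {}^{rrb}K_3, {}^{rbb}K_3\}$-free $2$-edge-colouring. (3) $G$ is the line graph of an incidence graph. (4) $G$ is a $\{\text{claw}, \text{diamond}, \text{odd-hole}, \text{even-butterfly}\}$-free graph.
   Context: Graphs are finite and simple. A $2$-edge-colouring of $G$ assigns to every edge the colour red or blue (not necessarily properly). For a set $\mathcal F$ of $2$-edge-coloured graphs, a $2$-edge-colouring of $G$ is $\mathcal F$-free if no induced $2$-edge-coloured subgraph is isomorphic (preserving colours) to a member of $\mathcal F$. Patterns on three vertices: ${}^rP_3$ (resp. ${}^bP_3$) is the path on three vertices with both edges red (resp. blue); ${}^rK_3$ (resp. ${}^bK_3$) is the triangle with all edges red (resp. blue); ${}^{rrb}K_3$ is the triangle with two red edges and one blue edge; ${}^{rbb}K_3$ is the triangle with one red edge and two blue edges. The line graph of $H$ has vertex set $E(H)$, two vertices being adjacent iff the corresponding edges share an endpoint. A graph is an incidence graph if it is bipartite with a bipartition $(X,Y)$ in which every vertex of $X$ has degree at most $2$. For uncoloured graphs, being free of a set of graphs means containing no induced subgraph isomorphic to a member. The claw is $K_{1,3}$; the diamond is $K_4$ minus one edge; an odd-hole is a chordless cycle of odd length at least $5$. For $n\ge 0$, the $n$-butterfly consists of two triangles joined by a path of length $n$ (one vertex of each triangle is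 an end of the path; for $n=0$ the two triangles share exactly one vertex). An even-butterfly is a $2n$-butterfly for some $n\ge 0$. *)

(* Defs.v *)
From Stdlib Require List.
From HB Require Import structures.
From mathcomp Require Import all_boot.

Set Implicit Arguments.
Unset Strict Implicit.
Unset Printing Implicit Defensive.

Record sgraph := SGraph {
  vertex :> finType;
  adj : rel vertex;
  adj_sym : symmetric adj;
  adj_irrefl : irreflexive adj }.

Notation "x -- y" := (adj x y) (at level 30, no associativity).

Section Generated.
Variables (T : finType) (r : rel T).
Definition gen_adj : rel T := [rel x y | (x != y) && (r x y || r y x)].
Lemma gen_adj_sym : symmetric gen_adj.
Proof. by move=> x y; rewrite /gen_adj /= eq_sym orbC. Qed.
Lemma gen_adj_irrefl : irreflexive gen_adj.
Proof. by move=> x; rewrite /gen_adj /= eqxx. Qed.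
(* The least simple graph on T in which distinct r-related points are
   adjacent. *)
Definition gen_graph := SGraph gen_adj_sym gen_adj_irrefl.
End Generated.

Definition edges (G : sgraph) : {set {set G}} :=
  [set [set x; y] | x in G, y in G & x -- y].

Section Induced.
Variables (G : sgraph) (S : {set G}).
Definition induced_adj : rel {x : G | x \in S} := [rel x y | val x -- val y].
Lemma induced_adj_sym : symmetric induced_adj.
Proof. by move=> x y; apply: adj_sym. Qed.
Lemma induced_adj_irrefl : irreflexive induced_adj.
Proof. by move=> x; apply: adj_irrefl. Qed.
Definition induced := SGraph induced_adj_sym induced_adj_irrefl.
End Induced.

Definition isomorphic (G H : sgraph) : Prop :=
  exists2 f : G -> H, bijective f & {mono f : x y / x -- y}.

Definition free (F : sgraph -> Prop) (G : sgraph) : Prop :=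
  forall (P : sgraph) (S : {set G}), F P -> ~ isomorphic (induced S) P.

Inductive colour := Red | Blue.

(* A 2-edge-colouring of G is a function c : {set G} -> colour, of which only
   the values on edges G are ever used. *)
Record cgraph := CGraph {
  cgraph_graph :> sgraph;
  edge_colour : {set cgraph_graph} -> colour }.

Definition cinduced (G : cgraph) (S : {set G}) : cgraph :=
  @CGraph (induced S)
          (fun e : {set induced S} => edge_colour (val @: e : {set G})).

Definition cisomorphic (G H : cgraph) : Prop :=
  exists f : G -> H,
    [/\ bijective f, {mono f : x y / x -- y} &
        forall e : {set G}, e \in edges G -> edge_colour (f @: e) = edge_colour e].

Definition cfree (F : cgraph -> Prop) (G : cgraph) : Prop :=
  forall (P : cgraph) (S : {set G}), F P -> ~ cisomorphic (cinduced S) P.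

Definition admits_free_colouring (F : cgraph -> Prop) (G : sgraph) : Prop :=
  exists c : {set G} -> colour, cfree F (CGraph c).

Definition path_graph (n : nat) : sgraph :=
  gen_graph [rel x y : 'I_n | y == x.+1 :> nat].
Definition complete_graph (n : nat) : sgraph :=
  gen_graph [rel _ _ : 'I_n | true].

Definition rP3 : cgraph := @CGraph (path_graph 3) (fun=> Red).
Definition bP3 : cgraph := @CGraph (path_graph 3) (fun=> Blue).
Definition rK3 : cgraph := @CGraph (complete_graph 3) (fun=> Red).
Definition bK3 : cgraph := @CGraph (complete_graph 3) (fun=> Blue).
Definition rrbK3 : cgraph :=
  @CGraph (complete_graph 3)
          (fun e => if e == [set ord0; ord_max] then Blue else Red).
Definition rbbK3 : cgraph :=
  @CGraph (complete_graph 3)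
          (fun e => if e == [set ord0; ord_max] then Red else Blue).

Section LineGraph.
Variable H : sgraph.
Definition line_adj : rel {e : {set H} | e \in edges H} :=
  [rel e f | (e != f) && (val e :&: val f != set0)].
Lemma line_adj_sym : symmetric line_adj.
Proof. by move=> e f; rewrite /line_adj /= eq_sym setIC. Qed.
Lemma line_adj_irrefl : irreflexive line_adj.
Proof. by move=> e; rewrite /line_adj /= eqxx. Qed.
Definition line_graph := SGraph line_adj_sym line_adj_irrefl.
End LineGraph.

Definition degree (G : sgraph) (x : G) : nat := #|[set y | x -- y]|.

(* The parts of a bipartition may be empty. *)
Definition bipartition (G : sgraph) (X Y : {set G}) : Prop :=
  [/\ X :|: Y = [set: G], [disjoint X & Y] &
      forall x y : G, x -- y ->
        (x \in X) && (y \in Y) || (x \in Y) && (y \in X)].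

Definition incidence_graph (G : sgraph) : Prop :=
  exists X Y : {set G},
    bipartition X Y /\ forall x, x \in X -> degree x <= 2.

Definition claw : sgraph := gen_graph [rel x _ : 'I_4 | x == ord0].

(* The only non-adjacent pair is {2, 3}. *)
Definition diamond : sgraph := gen_graph [rel x _ : 'I_4 | x < 2].

(* This is the n-cycle only for n >= 3. *)
Definition cycle_graph (n : nat) : sgraph :=
  gen_graph [rel x y : 'I_n | y == ordS x].

Definition odd_hole (P : sgraph) : Prop :=
  exists n, [/\ odd n, 5 <= n & P = cycle_graph n].

(* The path is 0 -- 1 -- ... -- n; the points (false, _) complete a triangle
   with its end 0 and the points (true, _) a triangle with its end n. *)
Definition butterfly_rel (n : nat) : rel ('I_n.+1 + bool * bool)%type :=
  fun u v => match u, v with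
  | inl i, inl j => j == i.+1 :> nat
  | inl i, inr (s, _) => i == if s then ord_max else ord0
  | inr (s, _), inr (t, _) => s == t
  | inr _, inl _ => false
  end.
Definition butterfly (n : nat) : sgraph := gen_graph (@butterfly_rel n).

Definition even_butterfly (P : sgraph) : Prop :=
  exists n, P = butterfly n.*2.

(* Main.v *)
Require Import Defs.
From Stdlib Require List.
From mathcomp Require Import all_boot.
From mathcomp Require Import zify.

(* A colouring as in (1) or (2) amounts to a Boolean function on the edges,
   true on triangles, that separates two edges at a vertex exactly when their
   other ends are not adjacent.  The classes of equally coloured edges at the
   vertices of G are then the vertices of an incidence graph with line graph G,
   and conversely the colour of an edge of a line graph records the side of the
   bipartition on which the common endpoint lies.

   Along an induced path the colours alternate, which rules out odd holes and
   even butterflies.  For the converse, if G has neither claws nor diamonds then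
   every edge lies in a unique maximal clique and every vertex in at most two of
   them, so a good colouring is a proper 2-colouring of the intersection graph Q
   of the maximal cliques for which all cliques with at least three vertices
   have the same colour.  A simple cycle in Q yields a hole of the same length
   (or is a triangle, which is impossible), so Q is bipartite; and a shortest
   path of Q, of odd length, between two cliques with at least three vertices
   yields an even butterfly.  Otherwise the colours of Q can be flipped
   componentwise. *)

Set Implicit Arguments.
Unset Strict Implicit.
Unset Printing Implicit Defensive.

(** * Walks and two-colourings *)

Section Walks.
Variables (T : finType) (e : rel T).
Hypothesis e_sym : symmetric e.

(** A walk is a total function of which only the values at 0, ..., [n] matter, so that cutting and
    shifting become index arithmetic. *)
Definition walk (p : nat -> T) (n : nat) := forall i, i < n -> e (p i) (p i.+1).

Definition skip (p : nat -> T) (i d k : nat) := if k <= i then p k else p (k + d).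

(** The condition on the jump is void when the cut reaches the end of the walk, where no step
    follows position [i]. *)
Lemma walk_skip p n i d :
  walk p n -> i + d <= n -> (i + d < n -> e (p i) (p (i + d).+1)) ->
  walk (skip p i d) (n - d).
Proof.
move=> wp le_n jump k lt_k; rewrite /skip.
case: (ltngtP k i) => [lt_ki|lt_ik|eq_ki].
- by apply: wp; lia.
- by rewrite addSn; apply: wp; lia.
- by rewrite eq_ki addSn; apply: jump; lia.
Qed.

Lemma skip_end p n i d :
  i + d <= n -> (i + d = n -> p i = p n) -> skip p i d (n - d) = p n.
Proof.
move=> le_n eq_n; rewrite /skip; case: leqP => [le_i|lt_i].
  by rewrite -[RHS]eq_n; [congr p; lia | lia].
by congr p; lia.
Qed.

(** A repeated vertex splits a closed walk into two shorter closed walks whose lengths add up to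
    [n], so one of them is odd; induction on the length applies to it. *)
Lemma odd_closed_walk_simple p n :
  walk p n -> p n = p 0 -> odd n ->
  exists q m, [/\ walk q m, q m = q 0, odd m &
    forall i j, i < j < m -> q i <> q j].
Proof.
have [k] := ubnP n; elim: k p n => // k IHk p n lt_nk wp p_n odd_n.
case: (boolP [exists i : 'I_n, exists j : 'I_n, (i < j) && (p i == p j)]).
  case/existsP=> i /existsP[j /andP[lt_ij /eqP eq_p]].
  have [lt_in lt_jn] := (ltn_ord i, ltn_ord j).
  have eq_j : i + (j - i) = j by lia.
  case: (boolP (odd (j - i))) => odd_d.
    apply: (IHk (fun l => p (i + l)) (j - i)) => //; first by lia.
    - by move=> l lt_l; rewrite addnS; apply: wp; lia.
    - by rewrite eq_j addn0.
  apply: (IHk (skip p i (j - i)) (n - (j - i))); first by lia.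
  - apply: walk_skip => //; first by lia.
    by move=> _; rewrite eq_p eq_j; apply: wp.
  - rewrite skip_end ?p_n //; lia.
  - by rewrite oddB; [rewrite odd_n (negbTE odd_d) | lia].
move/existsPn=> inj_p; exists p, n; split=> // i j /andP[lt_ij lt_jn] eq_p.
have /existsPn/(_ (Ordinal lt_jn)) := inj_p (Ordinal (ltn_trans lt_ij lt_jn)).
by rewrite /= lt_ij eq_p eqxx.
Qed.

(** A repetition or a chord gives a shortcut, to which induction on the length applies; a walk with
    neither is an induced path. *)
Lemma shortest_walk p n :
  walk p n -> exists q m, [/\ walk q m, q 0 = p 0, q m = p n &
    forall i j, i < j <= m -> q i <> q j /\ (e (q i) (q j) -> j = i.+1)].
Proof.
have [k] := ubnP n; elim: k p n => // k IHk p n lt_nk wp.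
pose bad (i j : 'I_n.+1) :=
  (i < j) && ((p i == p j) || e (p i) (p j) && (j != i.+1 :> nat)).
case: (boolP [exists i, exists j, bad i j]).
  case/existsP=> i /existsP[j /andP[lt_ij bad_ij]].
  have [lt_in lt_jn] := (ltn_ord i, ltn_ord j).
  case/orP: bad_ij => [/eqP eq_p | /andP[e_ij ne_j]].
    have eq_j : i + (j - i) = j by lia.
    have [||q [m [wq q0 qm Hq]]] := IHk (skip p i (j - i)) (n - (j - i)).
    - by lia.
    - apply: walk_skip => //; first by lia.
      by rewrite eq_j => lt_j; rewrite eq_p; apply: wp.
    exists q, m; split=> //; rewrite qm skip_end //; first by lia.
    by move=> eq_n; rewrite eq_p; congr p; lia.
  (* Unlike for a repetition, [p j] is kept here, so one entry fewer is dropped. *)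
  have eq_j : (i + (j - i.+1)).+1 = j by lia.
  have [||q [m [wq q0 qm Hq]]] := IHk (skip p i (j - i.+1)) (n - (j - i.+1)).
  - by lia.
  - by apply: walk_skip => //; [lia | rewrite eq_j].
  by exists q, m; split=> //; rewrite qm skip_end //; lia.
move/existsPn=> good; exists p, n; split=> // i j /andP[lt_ij le_jn].
have lt_in : i < n.+1 by lia.
have /existsPn/(_ (Ordinal (le_jn : j < n.+1))) := good (Ordinal lt_in).
rewrite /bad /= lt_ij negb_or negb_and negbK => /andP[/eqP ne_p chord].
by split=> // e_ij; move: chord; rewrite e_ij => /eqP.
Qed.

Lemma connect_walk x y : connect e x y -> exists p n, [/\ walk p n, p 0 = x & p n = y].
Proof.
case/connectP=> s /(pathP x) es ->; exists (nth x (x :: s)), (size s).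
by split=> //; rewrite nth_last.
Qed.

(** The bipartite double cover: the second coordinate flips at each step, so it records the parity
    of walks in [e]. *)
Definition double_cover : rel (T * bool) := [rel u v | e u.1 v.1 && (u.2 != v.2)].

Lemma double_cover_walk x b y c :
  connect double_cover (x, b) (y, c) ->
  exists p n, [/\ walk p n, p 0 = x, p n = y & odd n = b (+) c].
Proof.
case/connectP=> s /(pathP (x, b)) es def_yc.
pose q := nth (x, b) ((x, b) :: s).
exists (fun k => (q k).1), (size s).
have par k : k <= size s -> (q k).2 = b (+) odd k.
  elim: k => [|k IHk] lt_k; first by rewrite addbF.
  have /andP[_] := es k lt_k; rewrite -/(q k) -/(q k.+1) (IHk (ltnW lt_k)) /=.
  by rewrite addbN; case: (b (+) odd k) (nth _ _ _).2 => [] [].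
have def_end : q (size s) = (y, c) by rewrite def_yc /q nth_last.
split=> //; last by rewrite -[c]/(y, c).2 -def_end par ?addKb.
- by move=> k /es /andP[].
- by rewrite def_end.
Qed.

(** The colour of [x] tells whether its lift [(x, true)] is reachable in the double cover from the
    lift [(r x, true)] of the root of its component. At least one lift of each vertex is reachable,
    and both only if there is an odd closed walk. *)
Lemma bipartite_of_no_odd_closed_walk :
  (forall p n, walk p n -> p n = p 0 -> ~~ odd n) ->
  exists c : T -> bool, forall x y, e x y -> c x != c y.
Proof.
move=> no_odd.
have sym_conn : connect_sym double_cover.
  by apply: sym_connect_sym => u v; rewrite /double_cover /= e_sym eq_sym.
have sym_e : connect_sym e by apply: sym_connect_sym.
have lift x y b : connect e x y -> exists c, connect double_cover (x, b) (y, c).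
  case/connectP=> s; elim: s x b => [|z s IHs] x b /=.
    by move=> _ ->; exists b.
  case/andP=> e_xz path_s /(IHs z (~~ b) path_s)[c conn_c]; exists c.
  apply: connect_trans conn_c; apply: connect1.
  by rewrite /double_cover /= e_xz; case: b.
pose r := root e.
exists (fun x => connect double_cover (r x, true) (x, true)) => x y e_xy.
have eq_r : r y = r x by apply/esym/(rootP sym_e)/connect1.
have step b : connect double_cover (r x, true) (x, b) =
    connect double_cover (r x, true) (y, ~~ b).
  apply: same_connect_r => //; apply: connect1.
  by rewrite /double_cover /= e_xy; case: b.
rewrite eq_r step /=.
have [|c] := lift (r x) y true.
  by rewrite sym_e (connect_trans _ (connect_root e x)) // connect1 // e_sym.
case: (boolP (connect _ _ (y, true))) => [conn_t|nconn_t].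
  case: (boolP (connect _ _ (y, false))) => // conn_f.
  have : connect double_cover (y, true) (y, false).
    by apply: connect_trans conn_f; rewrite sym_conn.
  case/double_cover_walk=> p [n [wp p0 pn /= odd_n]] _.
  by have := no_odd p n wp; rewrite p0 pn odd_n => /(_ erefl).
by case: c => conn_c; [rewrite conn_c in nconn_t | rewrite conn_c].
Qed.

(** In each component, colours are taken relative to a reference vertex, which is big whenever the
    component has a big vertex. *)
Lemma flip_components (big : pred T) (c : T -> bool) :
  (forall x y, e x y -> c x != c y) ->
  (forall x y, big x -> big y -> connect e x y -> c x = c y) ->
  exists c' : T -> bool,
    (forall x y, e x y -> c' x != c' y) /\ (forall x, big x -> c' x).
Proof.
move=> proper_c big_c.
have sym_e : connect_sym e by apply: sym_connect_sym.
(* Both the pick and its default, the root, depend only on the component, so [r] is constant on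
   components. *)
pose r x := odflt (root e x) [pick y | big y && connect e x y].
exists (fun x => c x == c (r x)); split=> [x y e_xy|x big_x].
  have -> : r y = r x.
    rewrite /r (rootP sym_e (connect1 e_xy)); congr odflt; apply: eq_pick => z /=.
    by rewrite (same_connect sym_e (connect1 e_xy)).
  by have := proper_c _ _ e_xy; case: (c x) (c y) (c (r x)) => [] [] [].
rewrite /r; case: pickP => [y /andP[big_y conn_y]|none] /=.
  by rewrite (big_c x y).
by have := none x; rewrite big_x connect0.
Qed.

End Walks.

(** * Embeddings and coloured patterns *)

Lemma edgesP (G : sgraph) (e : {set G}) :
  reflect (exists x y : G, e = [set x; y] /\ x -- y) (e \in edges G).
Proof.
apply: (iffP imset2P) => [[x y _ + ->]|[x [y [-> xy]]]].
  by rewrite inE => xy; exists x, y.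
by exists x y; rewrite // inE.
Qed.

Lemma in_edges (G : sgraph) (x y : G) : x -- y -> [set x; y] \in edges G.
Proof. by move=> xy; apply/edgesP; exists x, y. Qed.

Lemma imset_set2 (aT rT : finType) (f : aT -> rT) x y :
  f @: [set x; y] = [set f x; f y].
Proof. by rewrite imsetU1 imset_set1. Qed.

Lemma adj_neq (G : sgraph) (x y : G) : x -- y -> x != y.
Proof. by apply: contraTneq => ->; rewrite adj_irrefl. Qed.

(** Induced copies are treated as injections preserving and reflecting adjacency, which avoids the
    subtypes in [induced]; [freeP] and [cfreeP] translate. *)
Definition embeds (P G : sgraph) :=
  exists2 f : P -> G, injective f & {mono f : x y / x -- y}.

Definition cembeds (P G : cgraph) :=
  exists f : P -> G, [/\ injective f, {mono f : x y / x -- y} &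
    forall x y, x -- y -> edge_colour [set f x; f y] = edge_colour [set x; y]].

Lemma imset_section (G P : finType) (f : P -> G) :
  injective f ->
  exists h : {x : G | x \in f @: setT} -> P, bijective h /\ forall u, f (h u) = val u.
Proof.
move=> inj_f.
have ex_h (u : {x : G | x \in f @: setT}) : exists p, f p = val u.
  by case: u => x /= /imsetP[p _ ->]; exists p.
have [h fh] := fin_all_exists ex_h; exists h; split=> //.
exists (fun p => exist _ (f p) (imset_f f (in_setT p))) => [u|p].
  by apply: val_inj; rewrite /= fh.
by apply: inj_f; rewrite fh.
Qed.

Lemma freeP (F : sgraph -> Prop) (G : sgraph) :
  free F G <-> forall P, F P -> ~ embeds P G.
Proof.
split=> [freeG P FP [f inj_f mono_f]|noG P S FP [h [g hK gK] mono_h]].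
  have [h [bij_h fh]] := imset_section inj_f.
  apply: (freeG P (f @: setT)) => //; exists h => // x y.
  by rewrite -mono_f !fh.
apply: (noG P FP); exists (val \o g) => [|x y].
  exact: inj_comp val_inj (can_inj gK).
by rewrite -{2}(gK x) -{2}(gK y) mono_h.
Qed.

Lemma cfreeP (F : cgraph -> Prop) (G : cgraph) :
  cfree F G <-> forall P, F P -> ~ cembeds P G.
Proof.
split=> [freeG P FP [f [inj_f mono_f col_f]]|noG P S FP [h [[g hK gK] mono_h col_h]]].
  have [h [bij_h fh]] := imset_section inj_f.
  have mono_h : {mono h : x y / (x : induced (f @: setT)) -- y >-> x -- y}.
    by move=> x y; rewrite -mono_f !fh.
  apply: (freeG P (f @: setT)) => //; exists h; split=> // e.
  case/edgesP=> x [y [-> xy]]; rewrite /= !imset_set2 -col_f ?fh //.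
  by rewrite mono_h.
apply: (noG P FP); exists (val \o g); split=> [|x y|x y xy].
- exact: inj_comp val_inj (can_inj gK).
- by rewrite -{2}(gK x) -{2}(gK y) mono_h.
have g_xy : (g x : cinduced S) -- g y by rewrite -mono_h !gK.
by have := col_h _ (in_edges g_xy); rewrite /= !imset_set2 !gK.
Qed.

Definition is_colour k l :=
  match k, l with Red, Red | Blue, Blue => true | _, _ => false end.
Definition other k := if k is Red then Blue else Red.

Lemma is_colourP k l : reflect (k = l) (is_colour k l).
Proof. by case: k l => [] []; constructor. Qed.

(* The value true stands for the colour allowed on triangles. *)
Definition good_colouring (G : sgraph) (c : {set G} -> bool) :=
  (forall x y z : G, x -- y -> x -- z -> y != z ->
     (c [set x; y] == c [set x; z]) = y -- z) /\
  (forall x y z : G, x -- y -> x -- z -> y -- z -> c [set x; y]).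

Lemma cembeds3 (P G : cgraph) (f : P -> G) (a b t : P) :
  (forall i, [\/ i = a, i = b | i = t]) ->
  f a != f b -> f a != f t -> f b != f t ->
  (f a -- f b = a -- b) -> (f a -- f t = a -- t) -> (f b -- f t = b -- t) ->
  (a -- b -> edge_colour [set f a; f b] = edge_colour [set a; b]) ->
  (a -- t -> edge_colour [set f a; f t] = edge_colour [set a; t]) ->
  (b -- t -> edge_colour [set f b; f t] = edge_colour [set b; t]) ->
  cembeds P G.
Proof.
move=> cases ab at_ bt eab eat ebt cab cat cbt.
exists f; split=> [x y|x y|x y].
- case: (cases x) (cases y) => [] -> [] -> // E; exfalso.
  + by rewrite E eqxx in ab.
  + by rewrite E eqxx in at_.
  + by rewrite E eqxx in ab.
  + by rewrite E eqxx in bt.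
  + by rewrite E eqxx in at_.
  + by rewrite E eqxx in bt.
- case: (cases x) (cases y) => [] -> [] -> //; rewrite ?adj_irrefl //.
  + by rewrite adj_sym [RHS]adj_sym.
  + by rewrite adj_sym [RHS]adj_sym.
  + by rewrite adj_sym [RHS]adj_sym.
case: (cases x) (cases y) => [] -> [] -> //; rewrite ?adj_irrefl //.
- by rewrite adj_sym setUC [in RHS]setUC.
- by rewrite adj_sym setUC [in RHS]setUC.
- by rewrite adj_sym setUC [in RHS]setUC.
Qed.

Lemma ord3_cases (i : 'I_3) : [\/ i = ord0, i = inord 1 | i = ord_max].
Proof.
by case: i => [[|[|[|//]]]] lt_i; [apply: Or31|apply: Or32|apply: Or33];
  apply: val_inj; rewrite /= ?inordK.
Qed.

(** The monochromatic triangle of colour [k] is the one allowed: [Red] gives the list of (1) and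
    [Blue] that of (2). *)
Definition patterns k (P : cgraph) :=
  List.In P [:: rP3; bP3; @CGraph (complete_graph 3) (fun=> other k); rrbK3; rbbK3].

#[local] Definition o0 : 'I_3 := ord0.
#[local] Definition o1 : 'I_3 := inord 1.
#[local] Definition o2 : 'I_3 := ord_max.

Lemma ord3_neq : [/\ (o0 == o1) = false, (o0 == o2) = false & (o1 == o2) = false].
Proof. by split; rewrite -val_eqE /= ?inordK. Qed.

Lemma path3_adj : [/\ (o0 : path_graph 3) -- o1, (o1 : path_graph 3) -- o2 &
  ((o0 : path_graph 3) -- o2) = false].
Proof.
have [n01 n02 n12] := ord3_neq; have v1 : o1 = 1 :> nat by rewrite inordK.
by split; rewrite /= /gen_adj /= ?n01 ?n02 ?n12 ?v1.
Qed.

Lemma complete3_adj : [/\ (o0 : complete_graph 3) -- o1,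
  (o1 : complete_graph 3) -- o2 & (o0 : complete_graph 3) -- o2].
Proof.
by have [n01 n02 n12] := ord3_neq; split; rewrite /= /gen_adj /= ?n01 ?n02 ?n12.
Qed.

Lemma set01_neq : ([set o0; o1] == [set o0; o2]) = false.
Proof.
case: ord3_neq => ne01 ne02 ne12; apply/eqP => /setP/(_ o1).
by rewrite !inE eqxx orbT [o1 == o0]eq_sym ne01 ne12.
Qed.

Lemma set12_neq : ([set o1; o2] == [set o0; o2]) = false.
Proof.
case: ord3_neq => ne01 ne02 ne12; apply/eqP => /setP/(_ o1).
by rewrite !inE eqxx [o1 == o0]eq_sym ne01 ne12.
Qed.

(** The pair [o0], [o2] is the nonadjacent one in the path and the odd one in the mixed triangles,
    so the centre of a path has to be passed as [y]. *)
Lemma cembeds_ord3 (r : rel 'I_3) d (G : cgraph) (x y z : G) :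
  let P := @CGraph (gen_graph r) d in
  x != y -> x != z -> y != z ->
  (x -- y = ((o0 : P) -- o1)) -> (x -- z = ((o0 : P) -- o2)) ->
  (y -- z = ((o1 : P) -- o2)) ->
  (x -- y -> edge_colour [set x; y] = d [set o0; o1]) ->
  (x -- z -> edge_colour [set x; z] = d [set o0; o2]) ->
  (y -- z -> edge_colour [set y; z] = d [set o1; o2]) ->
  cembeds P G.
Proof.
move=> P xy xz yz axy axz ayz cxy cxz cyz.
pose f (i : P) : G := nth x [:: x; y; z] (i : 'I_3).
have f0 : f o0 = x by [].
have f1 : f o1 = y by rewrite /f /= inordK.
have f2 : f o2 = z by [].
apply: (@cembeds3 P G f o0 o1 o2); rewrite ?f0 ?f1 ?f2 //.
- exact: ord3_cases.
- by rewrite -axy.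
- by rewrite -axz.
- by rewrite -ayz.
Qed.

Section ColouredPatterns.
Variables (G : sgraph) (c : {set G} -> colour) (k : colour).
Let cG := CGraph c.

(** The paths force different colours on edges to nonadjacent neighbours, the mixed triangles make
    every triangle monochromatic, and the remaining pattern fixes its colour as [k]. *)
Lemma patterns_free_good :
  cfree (patterns k) cG -> good_colouring (fun e => is_colour k (c e)).
Proof.
move/cfreeP=> free_c.
have noP (x y z : G) : x -- y -> x -- z -> y != z -> ~~ y -- z ->
    c [set x; y] <> c [set x; z].
  move=> xy xz ne_yz nyz eq_c.
  apply: (free_c (@CGraph (path_graph 3) (fun=> c [set x; y]))).
    by case: (c _); [left | right; left].
  have [a01 a12 a02] := path3_adj; apply: (@cembeds_ord3 _ _ cG y x z) => //=.
  - by rewrite eq_sym adj_neq.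
  - exact: adj_neq.
  - by rewrite adj_sym xy.
  - by rewrite (negbTE nyz).
  - by rewrite xz.
  - by rewrite setUC.
  - by rewrite (negbTE nyz).
have noT (x y z : G) : x -- y -> y -- z -> x -- z ->
    c [set x; y] = c [set y; z] -> c [set x; z] = c [set x; y].
  move=> xy yz xz eq_c; apply/is_colourP; apply/negPn/negP => ne_c.
  apply: (free_c (@CGraph (complete_graph 3)
    (fun e => if e == [set ord0; ord_max] then c [set x; z] else c [set x; y]))).
    move: ne_c; case: (c [set x; y]) (c [set x; z]) => [] [] // _.
      by do 3!right; left.
    by do 4!right; left.
  have [a01 a12 a02] := complete3_adj; apply: (@cembeds_ord3 _ _ cG x y z) => //=.
  - exact: adj_neq.
  - exact: adj_neq.
  - exact: adj_neq.
  - by rewrite xy.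
  - by rewrite yz.
  - by rewrite set01_neq.
  - by rewrite eqxx.
  - by rewrite set12_neq eq_c.
have tri (x y z : G) : x -- y -> x -- z -> y -- z -> c [set x; y] = k.
  move=> xy xz yz.
  have yx : y -- x by rewrite adj_sym.
  have zy : z -- y by rewrite adj_sym.
  have zx : z -- x by rewrite adj_sym.
  (* Two of the three edges have the same colour; the three instances cover all choices of the
     two. *)
  have t1 := noT x y z xy yz xz; have t2 := noT y x z yx xz yz.
  have t3 := noT x z y xz zy xy.
  rewrite (setUC [set y] [set x]) (setUC [set z] [set y]) in t2 t3.
  have [eq1 eq2] : c [set x; z] = c [set x; y] /\ c [set y; z] = c [set x; y].
    by move: t1 t2 t3; case: (c [set x; y]) (c [set x; z]) (c [set y; z]) =>
      [] [] [] t1 t2 t3; split=> //; first [have := t1 erefl | have := t2 erefl | have := t3 erefl].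
  have [//|ne] : c [set x; y] = k \/ c [set x; y] = other k.
    by case: (k) (c _) => [] []; [left|right|right|left].
  case: (free_c (@CGraph (complete_graph 3) (fun=> other k))); first by do 2!right; left.
  have [a01 a12 a02] := complete3_adj; apply: (@cembeds_ord3 _ _ cG x y z) => //=.
  - exact: adj_neq.
  - exact: adj_neq.
  - exact: adj_neq.
  - by rewrite xy.
  - by rewrite yz.
  - by rewrite eq1.
  - by rewrite eq2.
split=> x y z xy xz => [ne_yz|yz]; last by apply/is_colourP; rewrite (tri x y z).
have [yz|nyz] := boolP (y -- z).
  by rewrite (tri x y z) // (tri x z y) // ?eqxx // adj_sym.
by have := noP x y z xy xz ne_yz nyz; case: (k) (c _) (c _) => [] [] [].
Qed.

Lemma good_patterns_free :
  good_colouring (fun e => is_colour k (c e)) -> cfree (patterns k) cG.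
Proof.
move=> [pair tri]; apply/cfreeP => P inP.
have noP l : ~ cembeds (@CGraph (path_graph 3) (fun=> l)) cG.
  case=> f [inj_f mono_f col_f].
  have [a01 a12 a02] := path3_adj.
  have a10 : (o1 : path_graph 3) -- o0 by rewrite adj_sym.
  have ne : f o0 != f o2 by rewrite (inj_eq inj_f).
  have b10 : f o1 -- f o0 by rewrite mono_f.
  have b12 : f o1 -- f o2 by rewrite mono_f.
  have b02 : f o0 -- f o2 = false by rewrite mono_f.
  have := pair (f o1) (f o0) (f o2) b10 b12 ne.
  have /= -> := col_f o1 o0 a10; have /= -> := col_f o1 o2 a12.
  by rewrite eqxx => /esym; rewrite -[X in X -> _]/(f o0 -- f o2 = true) b02.
(* All edges of an embedded triangle have colour [k]. The two at [o0] suffice, since the mixed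
   triangles colour them differently. *)
have noT d : cembeds (@CGraph (complete_graph 3) d) cG ->
    d [set o0; o1] = k /\ d [set o0; o2] = k.
  case=> f [inj_f mono_f col_f].
  have [a01 a12 a02] := complete3_adj.
  have a21 : (o2 : complete_graph 3) -- o1 by rewrite adj_sym.
  have b01 : f o0 -- f o1 by rewrite mono_f.
  have b02 : f o0 -- f o2 by rewrite mono_f.
  have b12 : f o1 -- f o2 by rewrite mono_f.
  have b21 : f o2 -- f o1 by rewrite adj_sym.
  have /= <- := col_f o0 o1 a01; have /= <- := col_f o0 o2 a02.
  by split; apply/esym/is_colourP; [apply: (tri _ _ (f o2)) | apply: (tri _ _ (f o1))].
case: inP => [<-|[<-|[<-|[<-|[<-|[]]]]]]; try exact: noP.
- by case/noT=> /= + _; case: (k).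
- by case/noT; rewrite /= set01_neq eqxx => <-.
- by case/noT; rewrite /= set01_neq eqxx => <-.
Qed.

End ColouredPatterns.

(** * Line graphs of incidence graphs *)

Lemma set2_meet (aT bT : finType) (a a' : aT) (b b' : bT) :
  ([set inl a; inr b] :&: [set inl a'; inr b'] != set0) = (a == a') || (b == b').
Proof.
apply/set0Pn/orP => [[[z|z]]|[/eqP <-|/eqP <-]].
- by rewrite !inE !orbF => /andP[/eqP[->] /eqP[->]]; left.
- by rewrite !inE /= => /andP[/eqP[->] /eqP[->]]; right.
- by exists (inl a); rewrite !inE eqxx.
- by exists (inr b); rewrite !inE eqxx orbT.
Qed.

(** * From a good colouring to an incidence graph *)

Section GoodToLine.
Variables (G : sgraph) (c : {set G} -> bool).
Hypothesis good_c : good_colouring c.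

(** The class of [v] under being equal or joined by an edge of colour [b], which is an equivalence
    by [classP]. *)
Definition class (b : bool) (v : G) : {set G} :=
  [set w | (w == v) || (v -- w) && (c [set v; w] == b)].

(** For transitivity, two edges of the same colour at [x] have adjacent other ends, hence span a
    triangle, all of whose edges are coloured true. *)
Lemma classP b u v :
  reflect (u = v \/ u -- v /\ c [set u; v] = b) (class b u == class b v).
Proof.
have [pair tri] := good_c.
have sub x y : x -- y -> c [set x; y] = b -> class b x \subset class b y.
  move=> xy cxy; apply/subsetP=> w; rewrite !inE => /orP[/eqP->|/andP[xw cxw]].
    by rewrite adj_sym xy setUC cxy eqxx orbT.
  have [//|ne_wy] := eqVneq w y.
  have wy : y -- w.
    by rewrite -(pair x y w xy xw) ?cxy ?(eqP cxw) // eq_sym.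
  have yx : y -- x by rewrite adj_sym.
  have cyx : c [set y; x] = b by rewrite setUC.
  rewrite wy -cyx /=.
  by rewrite (tri y w x) ?(tri y x w) // adj_sym.
apply: (iffP eqP) => [eq_uv|[->//|[uv cuv]]].
  have : u \in class b v by rewrite -eq_uv inE eqxx.
  rewrite inE => /orP[/eqP|/andP[vu /eqP cvu]]; first by left.
  by right; rewrite adj_sym setUC.
by apply/eqP; rewrite eqEsubset !sub // 1?adj_sym // setUC.
Qed.

Lemma class_inj u v : class true u = class true v -> class false u = class false v -> u = v.
Proof.
move=> /eqP/classP[//|[_ ct]] /eqP/classP[//|[_]].
by rewrite ct.
Qed.

Lemma adj_class u v :
  u -- v = (u != v) && ((class false u == class false v) || (class true u == class true v)).
Proof.
apply/idP/andP=> [uv|[ne_uv /orP[]]]; last 2 first.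
- by case/classP=> [/eqP|[]]; rewrite ?(negbTE ne_uv).
- by case/classP=> [/eqP|[]]; rewrite ?(negbTE ne_uv).
split; first exact: adj_neq.
by apply/orP; case cuv: (c [set u; v]); [right|left]; apply/classP; right.
Qed.

(** Two edges coloured false at [v] would have adjacent other ends and lie in a triangle, whose
    edges are coloured true. *)
Lemma card_class_false v : #|class false v| <= 2.
Proof.
have [pair tri] := good_c.
rewrite leqNgt; apply/negP => /card_gt2P[x [y [z [[xv yv zv] [xy yz zx]]]]].
suff no2 (s t : G) : s \in class false v -> t \in class false v ->
    s != t -> s != v -> t != v -> False.
  have [eq_x|nx] := eqVneq x v.
    by apply: (no2 y z) => //; rewrite -eq_x // eq_sym.
  have [eq_y|ny] := eqVneq y v.
    by apply: (no2 x z) => //; rewrite -1?eq_y // eq_sym.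
  exact: (no2 x y).
rewrite !inE => /orP[->//|/andP[vs /eqP cs]] /orP[->//|/andP[vt /eqP ct]] ne_st _ _.
have st : s -- t by rewrite -(pair v s t) // cs ct.
by rewrite (tri v s t) in cs.
Qed.

(** False classes stand on the left and true classes on the right; [v] becomes the edge between its
    two classes. All other sets are isolated vertices. *)
Definition root_rel : rel ({set G} + {set G}) :=
  fun A B => if (A, B) is (inl a, inr b)
             then [exists v, (a == class false v) && (b == class true v)] else false.
Definition root_graph := gen_graph root_rel.

Lemma root_adj (A B : root_graph) :
  reflect (exists v, A = inl (class false v) /\ B = inr (class true v) \/
                     B = inl (class false v) /\ A = inr (class true v))
          (A -- B).
Proof.
apply: (iffP idP) => [|[v [] [-> ->]]].
- rewrite /= /gen_adj /= => /andP[_].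
  by case: A B => [a|a] [b|b] //=; rewrite ?orbF => /existsP[v /andP[/eqP-> /eqP->]];
    exists v; [left | right].
- by rewrite /= /gen_adj /=; apply/orP; left; apply/existsP; exists v; rewrite !eqxx.
- by rewrite /= /gen_adj /=; apply/existsP; exists v; rewrite !eqxx.
Qed.

(** The left side has bounded degree: the edges at [class false v] come from its members, of which
    there are at most two. *)
Lemma root_incidence : incidence_graph root_graph.
Proof.
exists [set A : root_graph | if A is inl _ then true else false].
exists [set A : root_graph | if A is inl _ then false else true].
split; first split.
- by apply/setP=> [] [a|a]; rewrite !inE.
- by rewrite disjoint_subset; apply/subsetP=> [] [a|a]; rewrite !inE.
- by move=> A B /root_adj[v [] [-> ->]]; rewrite !inE.
case=> a; rewrite inE // => _.
case: (pickP (fun v => a == class false v)) => [v /eqP ->|none].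
  apply: leq_trans (card_class_false v).
  apply: leq_trans (leq_imset_card (fun w => inr (class true w) : root_graph) _).
  apply: subset_leq_card; apply/subsetP=> B; rewrite inE => /root_adj[w [] [] //].
  move=> [eq_v] ->; apply: imset_f.
  by have /setP/(_ w) := eq_v; rewrite [in RHS]inE eqxx.
rewrite (_ : degree _ = 0) //; apply/eqP; rewrite cards_eq0; apply/eqP/setP => B.
rewrite !inE; apply/negP => /root_adj[w [] [] //] [eq_a] _.
by have := none w; rewrite eq_a eqxx.
Qed.

Definition root_edge (v : G) : {set root_graph} := [set inl (class false v); inr (class true v)].

Lemma root_edge_in v : root_edge v \in edges root_graph.
Proof. by apply: in_edges; apply/root_adj; exists v; left. Qed.

Lemma root_line : isomorphic G (line_graph root_graph).
Proof.
pose f v : line_graph root_graph := exist _ (root_edge v) (root_edge_in v).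
have inj_f : injective f.
  move=> u v /(congr1 val)/= /setP eq_uv; apply: class_inj.
    by have := eq_uv (inr (class true u)); rewrite !inE eqxx /= => /esym/eqP[].
  have := eq_uv (inl (class false u)).
  by rewrite !inE eqxx /= orbF => /esym/eqP[].
have ex_g (E : line_graph root_graph) : exists v, f v = E.
  case: E => E inE'; case/edgesP: (inE') => A [B [def_E /root_adj[v Hv]]].
  exists v; apply: val_inj => /=; rewrite def_E /root_edge.
  by case: Hv => [] [-> ->] //; rewrite setUC.
have [g fg] := fin_all_exists ex_g.
exists f => [|u v]; first by exists g => // v; apply: inj_f; rewrite fg.
by rewrite adj_class /= /line_adj /= set2_meet (inj_eq inj_f).
Qed.

End GoodToLine.

(** * From an incidence graph to a good colouring *)

Section LineToGood.
Variables (G : sgraph) (T : finType) (xc yc : G -> T).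
Hypothesis inj_xy : forall u v, xc u = xc v -> yc u = yc v -> u = v.
Hypothesis adj_xy : forall u v,
  u -- v = (u != v) && ((xc u == xc v) || (yc u == yc v)).
Hypothesis le2_x : forall u v w,
  u != v -> u != w -> v != w -> xc u = xc v -> xc u <> xc w.

(** Here [xc] and [yc] give the two ends of a vertex of [G] seen as an edge of a bipartite graph,
    and no [xc] end belongs to three of them. *)
Definition same_y (e : {set G}) := [forall u in e, forall v in e, yc u == yc v].

Lemma same_y2 u v : same_y [set u; v] = (yc u == yc v).
Proof.
apply/idP/idP => [/forall_inP/(_ u)|eq_uv].
  by rewrite set21 => /(_ isT)/forall_inP/(_ v); rewrite set22 => /(_ isT).
apply/forall_inP=> s /set2P[] ->; apply/forall_inP=> t /set2P[] ->;
by rewrite ?eqxx // eq_sym.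
Qed.

(** Two edges through the [yc] end of [x] lead to vertices sharing that end, and two through its
    [xc] end would put three vertices there. In a triangle, an edge through an [xc] end would force
    this or two vertices sharing both ends. *)
Lemma same_y_good : good_colouring same_y.
Proof.
have half u v : u -- v -> yc u != yc v -> xc u = xc v.
  by rewrite adj_xy => /andP[_ /orP[/eqP//|->]].
split=> x y z xy xz => [ne_yz|yz].
  rewrite !same_y2 adj_xy ne_yz /=.
  have [eq_xy|ne_xy] := eqVneq (yc x) (yc y); have [eq_xz|ne_xz] := eqVneq (yc x) (yc z).
  - by rewrite -eq_xy eq_xz !eqxx orbT.
  - rewrite -eq_xy (negbTE ne_xz) orbF /=; apply/esym/negP => /eqP eqx.
    have := half _ _ xz ne_xz => eqxz; move: (adj_neq xy).
    by rewrite (@inj_xy x y) ?eqxx // eqx.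
  - rewrite -eq_xz [yc y == _]eq_sym (negbTE ne_xy) orbF; apply/esym/negP => /eqP eqx.
    have := half _ _ xy ne_xy => eqxy; move: (adj_neq xz).
    by rewrite (@inj_xy x z) ?eqxx // -eqx.
  - by have := le2_x (adj_neq xy) (adj_neq xz) ne_yz (half _ _ xy ne_xy) (half _ _ xz ne_xz).
rewrite same_y2; apply/negPn/negP => ne_xy; have eqx := half _ _ xy ne_xy.
have [eq_xz|ne_xz] := eqVneq (yc x) (yc z); last first.
  by apply: le2_x (adj_neq xy) (adj_neq xz) (adj_neq yz) eqx (half _ _ xz ne_xz).
move: (adj_neq xz); rewrite (@inj_xy x z) ?eqxx // eqx; apply: half => //.
by rewrite -eq_xz eq_sym.
Qed.

End LineToGood.

Lemma line_incidence_good (G H : sgraph) :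
  incidence_graph H -> isomorphic G (line_graph H) ->
  exists c : {set G} -> bool, good_colouring c.
Proof.
case=> X [Y [[covXY disXY bip] deg2]] [f bij_f mono_f].
have XnY z : z \in X -> z \in Y -> False.
  by move=> zX; rewrite (disjointFr disXY zX).
(* Each edge of [H] is written with its end in [X] first. *)
have ex_xy v : exists p : H * H,
    [/\ val (f v) = [set p.1; p.2], p.1 \in X, p.2 \in Y & p.1 -- p.2].
  have /edgesP[a [b [-> ab]]] := valP (f v).
  case/orP: (bip _ _ ab) => /andP[inA inB]; first by exists (a, b).
  by exists (b, a); rewrite /= setUC adj_sym.
have [p Hp] := fin_all_exists ex_xy.
have inj_f := bij_inj bij_f.
have inj_p u v : (p u).1 = (p v).1 -> (p u).2 = (p v).2 -> u = v.
  move=> e1 e2; apply/inj_f/val_inj.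
  by have [-> _ _ _] := Hp u; have [-> _ _ _] := Hp v; rewrite e1 e2.
exists (same_y (fun v => (p v).2)); apply: (@same_y_good G H (fun v => (p v).1)) => //.
  move=> u v; rewrite -mono_f /= /line_adj /= (inj_eq inj_f); congr (_ && _).
  have [-> uX uY _] := Hp u; have [-> vX vY _] := Hp v.
  apply/set0Pn/orP => [[z]|[/eqP eq_uv|/eqP eq_uv]].
  - rewrite !inE => /andP[/orP[]/eqP-> /orP[]]; try by [left|right].
    + by move/eqP=> E; rewrite E in uX; case: (XnY _ uX vY).
    + by move/eqP=> E; rewrite E in uY; case: (XnY _ vX uY).
  - by exists (p u).1; rewrite !inE eq_uv eqxx.
  - by exists (p u).2; rewrite !inE eq_uv eqxx !orbT.
move=> u v w uv uw vw e1 e2; have [_ uX _ _] := Hp u.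
have := deg2 _ uX; rewrite leqNgt => /negP; apply; apply/card_gt2P.
exists (p u).2, (p v).2, (p w).2; rewrite !inE; split; first split.
- by have [] := Hp u.
- by rewrite e1; have [] := Hp v.
- by rewrite e2; have [] := Hp w.
split.
- by apply: contra uv => /eqP e; apply/eqP/inj_p.
- by apply: contra vw => /eqP e; apply/eqP/inj_p => //; rewrite -e1.
- by apply: contra uw => /eqP e; apply/eqP/inj_p.
Qed.

(** * Obstructions to a good colouring *)

Lemma modn_succ k n : k.+1 %% n.+1 = if k %% n.+1 == n then 0 else (k %% n.+1).+1.
Proof.
rewrite -[k.+1]addn1 -modnDml addn1; case: eqP => [->|ne]; first by rewrite modnn.
by rewrite modn_small //; have := ltn_pmod k (ltn0Sn n); lia.
Qed.

Section GoodToFree.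
Variables (G : sgraph) (c : {set G} -> bool).
Hypothesis good_c : good_colouring c.

(** Consecutive edges share a vertex whose two neighbours on the walk are distinct and nonadjacent,
    so their colours differ. *)
Lemma alternating (w : nat -> G) n :
  (forall k, k <= n -> w k -- w k.+1) ->
  (forall k, k < n -> w k != w k.+2 /\ ~~ w k -- w k.+2) ->
  c [set w n; w n.+1] = c [set w 0; w 1] (+) odd n.
Proof.
have [pair _] := good_c.
elim: n => [|n IHn] adj_w nadj_w; first by rewrite addbF.
have [ne /negbTE nadj] := nadj_w n (ltnSn n).
have := pair (w n.+1) (w n) (w n.+2).
rewrite adj_sym adj_w 1?ltnW // adj_w // ne nadj setUC => /(_ isT isT isT).
rewrite IHn => [|k le_kn|k lt_kn]; last 2 first.
- by apply: adj_w; rewrite ltnW.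
- by apply: nadj_w; rewrite ltnW.
by rewrite /= addbN; move: (c [set w n.+1; w n.+2]) (c [set w 0; w 1] (+) odd n) => [] [].
Qed.

(** The edges to three pairwise nonadjacent leaves would need three different Boolean colours. *)
Lemma good_no_claw : ~ embeds claw G.
Proof.
have [pair _] := good_c; case=> f inj_f mono_f.
pose i k lt_k : claw := @Ordinal 4 k lt_k.
have adj0 k lt_k : f (@i 0 isT) -- f (@i k.+1 lt_k) by rewrite mono_f.
have E j k lt_j lt_k : j != k ->
    c [set f (@i 0 isT); f (@i j.+1 lt_j)] != c [set f (@i 0 isT); f (@i k.+1 lt_k)].
  move=> ne_jk; rewrite pair ?mono_f /= ?/gen_adj /= ?andbF // (inj_eq inj_f).
  by rewrite -(inj_eq val_inj).
have := (E 0 1 isT isT isT, E 0 2 isT isT isT, E 1 2 isT isT isT).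
by case: (c _) (c _) (c _) => [] [] [] [[]].
Qed.

(** The edges from vertex 0 to the nonadjacent vertices 2 and 3 lie in triangles with vertex 1, so
    both are true, although they should differ. *)
Lemma good_no_diamond : ~ embeds diamond G.
Proof.
have [pair tri] := good_c; case=> f inj_f mono_f.
pose i k lt_k : diamond := @Ordinal 4 k lt_k.
have := pair (f (@i 0 isT)) (f (@i 2 isT)) (f (@i 3 isT)).
rewrite !mono_f (inj_eq inj_f) => /(_ isT isT isT).
rewrite (tri _ _ (f (@i 1 isT))) ?mono_f //.
by rewrite (tri _ _ (f (@i 1 isT))) ?mono_f.
Qed.

(** Colours alternate around the cycle and, its length being odd, return to the first edge with the
    opposite colour. *)
Lemma good_no_odd_hole P : odd_hole P -> ~ embeds P G.
Proof.
case=> [[|n] [odd_n ge_n ->]] [f inj_f mono_f]; first by [].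
pose u k : cycle_graph n.+1 := inord (k %% n.+1).
have val_u k : u k = k %% n.+1 :> nat by rewrite inordK // ltn_pmod.
have adj_u j k : u j -- u k = (j %% n.+1 != k %% n.+1) &&
    ((k %% n.+1 == j.+1 %% n.+1) || (j %% n.+1 == k.+1 %% n.+1)).
  rewrite /= /gen_adj /= -!(inj_eq val_inj) /= !val_u.
  by rewrite -[(j %% _).+1]addn1 -[(k %% _).+1]addn1 !modnDml !addn1.
have := @alternating (f \o u) n.+1.
have -> : (f \o u) n.+1 = (f \o u) 0 by rewrite /= /u modnn mod0n.
have -> : (f \o u) n.+2 = (f \o u) 1.
  by rewrite /= /u -[n.+2]addn1 -modnDml modnn.
rewrite odd_n addbT => alt.
suff : c [set (f \o u) 0; (f \o u) 1] = ~~ c [set (f \o u) 0; (f \o u) 1] by case: (c _).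
apply: alt => k _ /=; rewrite mono_f adj_u; last first.
  rewrite (inj_eq inj_f) -(inj_eq val_inj) /= !val_u !modn_succ.
  move: (k %% _) (ltn_pmod k (ltn0Sn n)) => r lt_r.
  have n0 : (0 == n) = false by lia.
  case: (eqVneq r n) => [->|ne_r] /=; first by rewrite n0 /=; case: (eqVneq 1 n) => ? /=; lia.
  by case: (eqVneq r.+1 n) => ?; rewrite ?n0; case: (eqVneq r.+2 n) => ? /=; lia.
rewrite !modn_succ; move: (k %% _) (ltn_pmod k (ltn0Sn n)) => r lt_r.
by case: (eqVneq r n) => [->|ne_r] /=; lia.
Qed.

(** Colours alternate along the path extended by one edge of each triangle. These two end edges are
    both true, but a path of even length between them makes them differ. *)
Lemma good_no_even_butterfly P : even_butterfly P -> ~ embeds P G.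
Proof.
have [_ tri] := good_c; case=> n ->; set N := n.*2 => [[f inj_f mono_f]].
(* Indices are shifted by one: [u 0] and [u N.+2] lie in the end triangles, and [u k.+1] is vertex
   [k] of the path. *)
pose u k : butterfly N :=
  if k is k'.+1 then if k' <= N then inl (inord k') else inr (true, true)
  else inr (false, true).
have inordE k : k <= N -> (inord k : 'I_N.+1) = k :> nat by move=> ?; rewrite inordK.
have eqI (i j : 'I_N.+1) : (i == j) = (i == j :> nat) by [].
have := @alternating (f \o u) N.+1.
rewrite /= (_ : odd N = false) ?odd_double // addbT ltnn leqnn => alt.
have c0 : c [set f (inr (false, true)); f (inl (inord 0))].
  apply: (tri _ _ (f (inr (false, false)))); rewrite mono_f /= /gen_adj //=.
    by rewrite eqI inordE.
  by rewrite eqI inordE.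
have c1 : c [set f (inl (inord N)); f (inr (true, true))].
  apply: (tri _ _ (f (inr (true, false)))); rewrite mono_f /= /gen_adj //=.
    by rewrite orbF eqI inordE.
  by rewrite orbF eqI inordE.
suff : c [set f (inl (inord N)); f (inr (true, true))] =
       ~~ c [set f (inr (false, true)); f (inl (inord 0))] by rewrite c0 c1.
apply: alt => k le_k.
  rewrite mono_f; case: k le_k => [|k] le_k /=.
    by rewrite /gen_adj /= eqI inordE.
  rewrite -ltnS le_k; case: ltnP => lt_k; rewrite /gen_adj /=.
    rewrite !inordE // eqxx andbT.
    by apply/eqP => [[/(congr1 val)]] /=; rewrite !inordE; lia.
  by rewrite orbF eqI /= inordE; lia.
rewrite mono_f (inj_eq inj_f); case: k le_k => [|k] le_k /=.
  case: ltnP => lt_N //; split=> //; rewrite /gen_adj /= eqI inordE //.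
rewrite (_ : k <= N) //; last by lia.
case: ltnP => lt_k; split=> //; rewrite /gen_adj /=.
- by apply/eqP => [[/(congr1 val)]] /=; rewrite !inordE; lia.
- by rewrite negb_and negb_or !inordE; lia.
- by rewrite orbF eqI /= inordE; lia.
Qed.

End GoodToFree.

(** * The intersection graph of the maximal cliques *)

Section CliqueGraph.
Variable G : sgraph.
Hypothesis no_claw : ~ embeds claw G.
Hypothesis no_diamond : ~ embeds diamond G.

Lemma claw_free (v a b t : G) : v -- a -> v -- b -> v -- t -> a != b -> a != t -> b != t ->
  [|| a -- b, a -- t | b -- t].
Proof.
move=> va vb vt ab at_ bt; apply/negPn/negP; rewrite !negb_or.
case/and3P=> /negbTE nab /negbTE nat /negbTE nbt; apply: no_claw.
have [[nva nvb] nvt] := (adj_neq va, adj_neq vb, adj_neq vt).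
have [av bv tv] : [/\ a -- v, b -- v & t -- v] by split; rewrite adj_sym.
have [nba nta ntb] : [/\ b -- a = false, t -- a = false & t -- b = false].
  by split; rewrite adj_sym.
exists (fun i : claw => nth v [:: v; a; b; t] (i : 'I_4)).
  move=> [i lt_i] [j lt_j] /= eq_ij; apply: val_inj => /=; apply/eqP.
  rewrite -(@nth_uniq _ v [:: v; a; b; t]) ?eq_ij //= !inE !negb_or.
  by rewrite nva nvb nvt ab at_ bt.
by case=> [[|[|[|[|//]]]] lt_i] [[|[|[|[|//]]]] lt_j];
  rewrite /= /gen_adj /= ?adj_irrefl ?va ?vb ?vt ?av ?bv ?tv ?nab ?nat ?nbt ?nba ?nta ?ntb.
Qed.

Lemma diamond_free (a b u v : G) : a -- b -> a -- u -> a -- v -> b -- u -> b -- v ->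
  u != v -> u -- v.
Proof.
move=> ab au av bu bv ne_uv; apply/negPn/negP => /negbTE nuv; apply: no_diamond.
have [[nab nau] nav] := (adj_neq ab, adj_neq au, adj_neq av).
have [nbu nbv] := (adj_neq bu, adj_neq bv).
have [ba ua va] : [/\ b -- a, u -- a & v -- a] by split; rewrite adj_sym.
have [ub vb nvu] : [/\ u -- b, v -- b & v -- u = false] by split; rewrite adj_sym.
exists (fun i : diamond => nth a [:: a; b; u; v] (i : 'I_4)).
  move=> [i lt_i] [j lt_j] /= eq_ij; apply: val_inj => /=; apply/eqP.
  rewrite -(@nth_uniq _ a [:: a; b; u; v]) ?eq_ij //= !inE !negb_or.
  by rewrite nab nau nav nbu nbv ne_uv.
by case=> [[|[|[|[|//]]]] lt_i] [[|[|[|[|//]]]] lt_j];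
  rewrite /= /gen_adj /= ?adj_irrefl ?ab ?au ?av ?bu ?bv ?ba ?ua ?va ?ub ?vb ?nuv ?nvu.
Qed.

(* Without diamonds, the hull of an edge is the only maximal clique containing it. *)
Definition hull (e : {set G}) : {set G} := [set z | [forall u in e, (z == u) || z -- u]].

Lemma in_hull (x y z : G) : (z \in hull [set x; y]) = ((z == x) || z -- x) && ((z == y) || z -- y).
Proof.
rewrite inE; apply/forall_inP/andP => [H|[zx zy] u /set2P[] ->] //.
by split; apply: H; rewrite ?set21 ?set22.
Qed.

Lemma hull_l (x y : G) : x -- y -> x \in hull [set x; y].
Proof. by move=> xy; rewrite in_hull eqxx xy orbT. Qed.

Lemma hull_r (x y : G) : x -- y -> y \in hull [set x; y].
Proof. by move=> xy; rewrite setUC hull_l // adj_sym. Qed.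

(** Two vertices of the hull other than [x] and [y] are common neighbours of these, and would span a
    diamond if nonadjacent. *)
Lemma hull_adj (x y u v : G) : x -- y -> u \in hull [set x; y] -> v \in hull [set x; y] ->
  u != v -> u -- v.
Proof.
rewrite !in_hull => xy /andP[ux uy] /andP[vx vy] ne_uv.
have [eq_ux|nux] := eqVneq u x; first by move: vx; rewrite -eq_ux eq_sym (negbTE ne_uv) adj_sym.
have [eq_uy|nuy] := eqVneq u y; first by move: vy; rewrite -eq_uy eq_sym (negbTE ne_uv) adj_sym.
have [eq_vx|nvx] := eqVneq v x; first by move: ux; rewrite -eq_vx (negbTE ne_uv).
have [eq_vy|nvy] := eqVneq v y; first by move: uy; rewrite -eq_vy (negbTE ne_uv).
rewrite (negbTE nux) (negbTE nuy) (negbTE nvx) (negbTE nvy) /= in ux uy vx vy.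
by apply: (@diamond_free x y); rewrite // adj_sym.
Qed.

(** By [hull_adj] the hull of [x], [y] lies in that of [u], [v]. The latter then contains [x] and
    [y], and the same argument gives the converse. *)
Lemma hull_eq (x y u v : G) : x -- y -> u \in hull [set x; y] -> v \in hull [set x; y] ->
  u != v -> hull [set u; v] = hull [set x; y].
Proof.
move=> xy ux vx ne_uv; have uv := hull_adj xy ux vx ne_uv.
have sub a b s t : a -- b -> s \in hull [set a; b] -> t \in hull [set a; b] ->
    hull [set a; b] \subset hull [set s; t].
  move=> ab sa ta; apply/subsetP=> z za; rewrite in_hull.
  have near w : w \in hull [set a; b] -> (z == w) || z -- w.
    by move=> wa; have [//|ne_zw] := eqVneq z w; apply: (hull_adj ab).
  by rewrite !near.
have mem_h z : z \in hull [set x; y] -> z \in hull [set u; v].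
  by apply/(subsetP (sub x y u v xy ux vx)).
apply/eqP; rewrite eqEsubset !sub // mem_h ?hull_l ?hull_r //.
Qed.

(** The maximal cliques with at least two vertices; isolated vertices of [G] contribute none. *)
Definition cliques : {set {set G}} := hull @: edges G.

Lemma hull_clique (x y : G) : x -- y -> hull [set x; y] \in cliques.
Proof. by move=> xy; apply/imset_f/in_edges. Qed.

Lemma clique_adj A (u v : G) : A \in cliques -> u \in A -> v \in A -> u != v -> u -- v.
Proof. by case/imsetP=> _ /edgesP[x [y [-> xy]]] ->; apply: hull_adj. Qed.

Lemma clique_hull A (u v : G) : A \in cliques -> u \in A -> v \in A -> u != v ->
  hull [set u; v] = A.
Proof. by case/imsetP=> _ /edgesP[x [y [-> xy]]] ->; apply: hull_eq. Qed.

Lemma clique_inter A B u v : A \in cliques -> B \in cliques -> A != B ->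
  u \in A -> u \in B -> v \in A -> v \in B -> u = v.
Proof.
move=> clA clB neAB uA uB vA vB; apply: contraNeq neAB => ne_uv.
by rewrite -(clique_hull clA uA vA ne_uv) (clique_hull clB uB vB ne_uv).
Qed.

Lemma clique_other A v : A \in cliques -> exists2 u, u \in A & u != v.
Proof.
case/imsetP=> _ /edgesP[x [y [-> xy]]] ->; have ne_xy := adj_neq xy.
have [eq_xv|ne_xv] := eqVneq x v; last by exists x; rewrite ?hull_l.
by exists y; rewrite ?hull_r // -eq_xv eq_sym.
Qed.

(** One further vertex from each of three different cliques at [v] would give a claw. *)
Lemma two_cliques A B C v : A \in cliques -> B \in cliques -> C \in cliques ->
  v \in A -> v \in B -> v \in C -> A != B -> C = A \/ C = B.
Proof.
move=> clA clB clC vA vB vC neAB.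
have [->|neCA] := eqVneq C A; first by left.
have [->|neCB] := eqVneq C B; first by right.
have [a aA nav] := clique_other v clA; have [b bB nbv] := clique_other v clB.
have [t tC ntv] := clique_other v clC.
have va : v -- a by rewrite (clique_adj clA) // eq_sym.
have vb : v -- b by rewrite (clique_adj clB) // eq_sym.
have vt : v -- t by rewrite (clique_adj clC) // eq_sym.
have apart X Y x y : X \in cliques -> Y \in cliques -> X != Y -> v \in X -> v \in Y ->
    x \in X -> y \in Y -> x != v -> y != v -> x != y /\ ~~ x -- y.
  move=> clX clY neXY vX vY xX yY nxv nyv.
  have ne_xy : x != y.
    apply: contraNneq nxv => eq_xy; apply/eqP.
    by apply: (clique_inter clX clY neXY); rewrite // eq_xy.
  (* An edge [x -- y] would put [y] in the hull of [v] and [x], which is [X], so that [X] and [Y]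
     would share [v] and [y]. *)
  split=> //; apply: contra neXY => xy.
  have vx : v -- x by rewrite (clique_adj clX) // eq_sym.
  have vy : v -- y by rewrite (clique_adj clY) // eq_sym.
  rewrite -(clique_hull clX vX xX) 1?eq_sym // -(clique_hull clY vY yY) 1?eq_sym //.
  apply/eqP/esym/hull_eq; rewrite ?hull_l // 1?eq_sym //.
  by rewrite in_hull [y -- v]adj_sym vy [y -- x]adj_sym xy !orbT.
have [nab /negbTE ab] := apart A B a b clA clB neAB vA vB aA bB nav nbv.
have [nta /negbTE ta] := apart C A t a clC clA neCA vC vA tC aA ntv nav.
have [ntb /negbTE tb] := apart C B t b clC clB neCB vC vB tC bB ntv nbv.
have := claw_free va vb vt nab; rewrite [a == t]eq_sym [b == t]eq_sym.
by rewrite [a -- t]adj_sym [b -- t]adj_sym nta ntb ab ta tb => /(_ isT isT).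
Qed.

Definition meet : rel {set G} :=
  [rel A B | [&& A != B, A \in cliques, B \in cliques & A :&: B != set0]].

Lemma meet_sym : symmetric meet.
Proof. by move=> A B; rewrite /meet /= eq_sym setIC [(A \in _) && _]andbCA. Qed.

Lemma meetI A B v : A \in cliques -> B \in cliques -> v \in A -> v \in B -> A != B -> meet A B.
Proof.
move=> clA clB vA vB neAB; rewrite /meet /= neAB clA clB /=.
by apply/set0Pn; exists v; rewrite inE vA vB.
Qed.

Lemma meet_point A B : meet A B -> exists v, v \in A /\ v \in B.
Proof. by case/and4P=> _ _ _ /set0Pn[v /setIP[]]; exists v. Qed.

(** Common points [f i] of consecutive cliques form the hole: [f i] lies in no other clique, so
    distinct [f i] and [f j] are adjacent exactly when they share a clique of the walk. *)
Lemma odd_hole_of_closed_walk q m :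
  walk meet q m -> q m = q 0 -> odd m -> (forall i j, i < j < m -> q i <> q j) ->
  exists2 P, odd_hole P & embeds P G.
Proof.
move=> wq qm odd_m inj_q; case: m wq qm odd_m inj_q => // n wq qm odd_n inj_q.
have ge2 : 1 < n.
  case: n wq qm odd_n inj_q => [|[]] // wq qm; have := wq 0 isT.
  by rewrite qm /meet /= eqxx.
pose Q (i : 'I_n.+1) := q i.
have injQ : injective Q.
  move=> i j eqQ; apply: val_inj => /=; case: (ltngtP i j) => // lt_ij.
    by case: (inj_q i j); rewrite ?lt_ij //=.
  by case: (inj_q j i); rewrite ?lt_ij //=.
have QS i : Q (ordS i) = q i.+1.
  rewrite /Q /=; have [eq_i|ne_i] := eqVneq (i : nat) n.
    by rewrite eq_i modnn qm.
  by rewrite modn_small //; have := ltn_ord i; lia.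
have mQ i : meet (Q i) (Q (ordS i)) by rewrite QS; apply: wq.
have clQ i : Q i \in cliques by case/and4P: (mQ i).
have [f Hf] := fin_all_exists (fun i => meet_point (mQ i)).
have neS i : Q i != Q (ordS i) by case/and4P: (mQ i).
have only i C : C \in cliques -> f i \in C -> C = Q i \/ C = Q (ordS i).
  by move=> clC fC; have [f1 f2] := Hf i; apply: (two_cliques _ _ _ f1 f2).
(* The walk has at least three cliques, so two steps never return to the start; hence different
   points never have the same two cliques. *)
have SS (i : 'I_n.+1) : ordS (ordS i) <> i.
  move=> eqS; have : (i.+1 %% n.+1).+1 %% n.+1 = i by have := congr1 val eqS.
  rewrite modn_succ modn_mod modn_succ modn_small //.
  have lt_i := ltn_ord i.
  case: (eqVneq (i : nat) n) => [->|ne_i] /=.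
    by case: (eqVneq 0 n) => //=; lia.
  by case: (eqVneq i.+1 n) => /=; lia.
have inj_f : injective f.
  move=> i j eq_f; have [fi1 fi2] := Hf i; have [fj1 fj2] := Hf j.
  case: (only i (Q j)); rewrite ?eq_f // => /injQ // eq_j.
  case: (only j (Q i)); rewrite -?eq_f // => /injQ // eq_i.
  by case: (SS i); rewrite -eq_j -eq_i.
have mono_f : {mono f : x y / (x : cycle_graph n.+1) -- y >-> x -- y}.
  move=> i j; have [fi1 fi2] := Hf i; have [fj1 fj2] := Hf j.
  rewrite [RHS]/= /gen_adj /= -(inj_eq inj_f).
  apply/idP/andP => [fij|[ne_f /orP[]/eqP eq_S]]; last 2 first.
  - by apply: (clique_adj (clQ j)) => //; rewrite eq_S.
  - by apply: (clique_adj (clQ i)) => //; rewrite eq_S.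
  have ne_f := adj_neq fij; split=> //.
  have ne_ij : i <> j by move=> eq_ij; rewrite eq_ij eqxx in ne_f.
  have clC := hull_clique fij.
  (* The clique of the edge is one of the two at [f i] and one of the two at [f j], which leaves
     only neighbouring indices. *)
  have [Ci|Ci] := only i _ clC (hull_l fij); have [Cj|Cj] := only j _ clC (hull_r fij);
    rewrite Ci in Cj; move/injQ: Cj.
  - by [].
  - by move=> ->; rewrite eqxx orbT.
  - by move=> <-; rewrite eqxx.
  - by move/ordS_inj.
exists (cycle_graph n.+1); last by exists f.
exists n.+1; split=> //.
(* It remains to exclude length 3. Then [f i2] is adjacent to [f i0] and [f i1], whose clique is
   [Q i1], and so lies in [Q i1]; but its only cliques are [Q i2] and [Q i0]. *)
case: (ltngtP n 3) => // [lt_n3|eq_n]; last by move: odd_n; rewrite eq_n.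
have {lt_n3} eq_n : n = 2 by lia.
rewrite {}eq_n in Q f wq qm inj_q ge2 odd_n injQ QS mQ clQ Hf neS only SS inj_f mono_f *.
have adjf i j : i != j -> f i -- f j.
  by move=> ne_ij; rewrite mono_f; case: i j ne_ij => [[|[|[|//]]] ?] [[|[|[|//]]] ?].
pose i0 : 'I_3 := @Ordinal 3 0 isT; pose i1 : 'I_3 := @Ordinal 3 1 isT.
pose i2 : 'I_3 := @Ordinal 3 2 isT.
have S0 : ordS i0 = i1 by apply: val_inj.
have S1 : ordS i1 = i2 by apply: val_inj.
have [_ f01] := Hf i0; have [f11 _] := Hf i1; rewrite S0 in f01.
have f21 : f i2 \in Q i1.
  rewrite -(clique_hull (clQ i1) f01 f11) ?(inj_eq inj_f) //.
  by rewrite in_hull !adjf ?orbT.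
by case: (only i2 (Q i1)) => // /injQ /(congr1 val).
Qed.

Definition big (A : {set G}) := (A \in cliques) && (2 < #|A|).

Lemma big_two A v : big A -> exists a : bool -> G,
  injective a /\ forall t, a t \in A /\ a t != v.
Proof.
case/andP=> _ card_A.
have /card_gt1P[x [y [xA yA ne_xy]]] : 1 < #|A :\ v|.
  by have := cardsD1 v A; case: (v \in A) card_A => /=; lia.
exists (fun t => if t then x else y); split=> [[] [] // /eqP|t].
- by rewrite (negbTE ne_xy).
- by rewrite eq_sym (negbTE ne_xy).
by case: t; [move: xA | move: yA]; rewrite !inE => /andP[-> ->].
Qed.

(** The ends differ in colour, so the length [N.+1] is odd. Common points [v i] of consecutive
    cliques form the path of length [N], and two further vertices of each end clique complete the
    triangles. *)
Lemma even_butterfly_of_walk (c : {set G} -> bool) q m :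
  (forall A B, meet A B -> c A != c B) ->
  walk meet q m -> big (q 0) -> big (q m) -> c (q 0) <> c (q m) ->
  (forall i j, i < j <= m -> q i <> q j /\ (meet (q i) (q j) -> j = i.+1)) ->
  exists2 P, even_butterfly P & embeds P G.
Proof.
move=> proper_c wq big0 bigm ne_c short.
have par k : k <= m -> c (q k) = c (q 0) (+) odd k.
  elim: k => [|k IHk] lt_km; first by rewrite addbF.
  have := proper_c _ _ (wq k lt_km); rewrite IHk ?(ltnW lt_km) // addbN.
  by move: (c (q 0) (+) odd k) (c (q k.+1)) => [] [].
have odd_m : odd m by move: ne_c; rewrite (par m) //; case: (c _) (odd m) => [] [].
have [N def_m even_N] : exists2 N, m = N.+1 & N = (m./2).*2.
  by exists m.-1; have := odd_double_half m; rewrite odd_m; lia.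
rewrite {}def_m in wq bigm ne_c short par *.
have {even_N odd_m} [n def_N] : exists n, N = n.*2 by eexists; apply: even_N.
have inj_q i j : i <= N.+1 -> j <= N.+1 -> q i = q j -> i = j.
  move=> le_i le_j eq_q; case: (ltngtP i j) => // lt_ij.
    by have [|/(_ eq_q)] := short i j; first by rewrite lt_ij.
  by have [|/(_ (esym eq_q))] := short j i; first by rewrite lt_ij.
have clq k : k <= N.+1 -> q k \in cliques.
  case: k => [|k] le_k; first by case/andP: big0.
  by case/and4P: (wq k le_k).
have [v Hv] := fin_all_exists (fun i : 'I_N.+1 => meet_point (wq i (ltn_ord i))).
have only (i : 'I_N.+1) C : C \in cliques -> v i \in C ->
    exists k : nat, [/\ k <= N.+1, C = q k & k = i \/ k = i.+1].
  move=> clC vC; have [v1 v2] := Hv i; have lt_i := ltn_ord i.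
  have ne_q : q i != q i.+1 by case/and4P: (wq i lt_i).
  have [] := two_cliques (clq i (ltnW lt_i)) (clq i.+1 lt_i) clC v1 v2 vC ne_q => ->.
    by exists i; split; [apply: ltnW | | left].
  by exists i.+1; split=> //; right.
have [a [inj_a Ha]] := big_two (v ord0) big0.
have [b [inj_b Hb]] := big_two (v ord_max) bigm.
(* For positive [k], the absence of chords gives [k = 1]; then [a t] and [v ord0] are both common to
   [q 0] and [q 1], hence equal, which is excluded. *)
have a_only t k : k <= N.+1 -> a t \in q k -> k = 0.
  case: k => // k le_k atk; have [at0 /eqP[]] := Ha t.
  have [|ne_q chord] := short 0 k.+1; first by [].
  have m0k : meet (q 0) (q k.+1).
    by apply: (meetI (clq 0 _) (clq _ le_k) at0 atk) => //; apply/eqP.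
  have [v1 v2] := Hv ord0; case: (chord m0k) => eq_k; rewrite eq_k in atk le_k ne_q.
  by apply: (clique_inter (clq 0 _) (clq 1 _) _ at0 atk v1 v2) => //; apply/eqP.
have b_only t k : k <= N.+1 -> b t \in q k -> k = N.+1.
  rewrite leq_eqVlt => /orP[/eqP//|lt_k] btk; have [btm /eqP[]] := Hb t.
  have [|ne_q chord] := short k N.+1; first by rewrite lt_k leqnn.
  have mkm : meet (q k) (q N.+1).
    by apply: (meetI (clq k _) (clq N.+1 _) btk btm); rewrite // ?(ltnW lt_k) //; apply/eqP.
  have [v1 v2] := Hv ord_max; case: (chord mkm) => eq_k; rewrite -eq_k in btk ne_q.
  by apply: (clique_inter (clq N _) (clq N.+1 _) _ btk btm v1 v2) => //; apply/eqP.
have neq_ab t s : a t != b s.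
  apply/eqP=> eq_ab; have [bsm _] := Hb s.
  by have := a_only t N.+1 (leqnn _); rewrite eq_ab => /(_ bsm).
(* The clique of such an edge would meet both end cliques and differ from both in colour, forcing
   their colours to agree. *)
have nadj_ab t s : a t -- b s = false.
  apply/negP=> ab; have [[at0 _] [bsm _]] := (Ha t, Hb s).
  have [clC aC bC] := And3 (hull_clique ab) (hull_l ab) (hull_r ab).
  set C := hull _ in clC aC bC.
  have ne0 : q 0 != C.
    by apply: contraTneq bC => <-; apply/negP=> /(b_only s 0 isT).
  have nem : C != q N.+1.
    by apply: contraTneq aC => ->; apply/negP=> /(a_only t N.+1 (leqnn _)).
  have m0 := proper_c _ _ (meetI (clq 0 isT) clC at0 aC ne0).
  have mm := proper_c _ _ (meetI clC (clq N.+1 (leqnn _)) bC bsm nem).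
  by case: (c _) (c _) (c _) ne_c m0 mm => [] [] [].
have adj_av t (i : 'I_N.+1) : a t -- v i = (i == ord0).
  have [at0 nav] := Ha t.
  apply/idP/eqP=> [av|->]; last first.
    by have [v1 _] := Hv ord0; apply: (clique_adj (clq 0 _)) => //.
  have [k [le_k eqC def_k]] := only i _ (hull_clique av) (hull_r av).
  have := hull_l av; rewrite eqC => /(a_only _ _ le_k) k0.
  by apply: val_inj => /=; lia.
have adj_bv t (i : 'I_N.+1) : b t -- v i = (i == ord_max).
  have [btm nbv] := Hb t.
  apply/idP/eqP=> [bv|->]; last first.
    by have [_ v2] := Hv ord_max; apply: (clique_adj (clq N.+1 _)) => //.
  have [k [le_k eqC def_k]] := only i _ (hull_clique bv) (hull_r bv).
  have := hull_l bv; rewrite eqC => /(b_only _ _ le_k) k0.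
  by apply: val_inj => /=; have := ltn_ord i; lia.
have neq_av t i : a t != v i.
  apply/eqP=> eq_av; have [v1 v2] := Hv i.
  by have := a_only t i.+1 (ltn_ord i); rewrite eq_av => /(_ v2).
have neq_bv t i : b t != v i.
  apply/eqP=> eq_bv; have [v1 v2] := Hv i; have lt_i := ltn_ord i.
  have := b_only t i (ltnW lt_i); rewrite eq_bv => /(_ v1); lia.
have inj_v : injective v.
  move=> i j eq_v; apply: val_inj => /=.
  have [[i1 i2] [j1 j2]] := (Hv i, Hv j).
  have [lt_i lt_j] := (ltn_ord i, ltn_ord j).
  rewrite eq_v in i1 i2; rewrite -eq_v in j1 j2.
  have [k [le_k /inj_q eq_k def_k]] := only i _ (clq _ (ltnW lt_j)) j1.
  have [l [le_l /inj_q eq_l def_l]] := only j _ (clq _ (ltnW lt_i)) i1.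
  by rewrite -eq_k ?(ltnW lt_j) // -eq_l ?(ltnW lt_i) // in def_k def_l; lia.
have adj_v i j : v i -- v j = (j == i.+1 :> nat) || (i == j.+1 :> nat).
  have [[i1 i2] [j1 j2]] := (Hv i, Hv j).
  have [lt_i lt_j] := (ltn_ord i, ltn_ord j).
  apply/idP/orP=> [vv|[]/eqP eq_S]; last 2 first.
  - apply: (clique_adj (clq i.+1 _)); rewrite // -?eq_S // (inj_eq inj_v).
    by rewrite -(inj_eq val_inj) /= eq_S; lia.
  - apply: (clique_adj (clq j.+1 _)); rewrite // -?eq_S // (inj_eq inj_v).
    by rewrite -(inj_eq val_inj) /= eq_S; lia.
  have ne_ij : i != j by rewrite -(inj_eq inj_v) adj_neq.
  rewrite -(inj_eq val_inj) /= in ne_ij.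
  have [k [le_k eq_k def_k]] := only i _ (hull_clique vv) (hull_l vv).
  have [l [le_l eq_l def_l]] := only j _ (hull_clique vv) (hull_r vv).
  have eq_kl : k = l by apply: inj_q; rewrite // -eq_k.
  by case: (eqVneq (j : nat) i.+1) => ?; [left | right]; lia.
pose f (u : butterfly N) : G :=
  match u with inl i => v i | inr (s, t) => if s then b t else a t end.
exists (butterfly N); first by exists n; rewrite def_N.
exists f => [[i|[[] t]] [j|[[] s]] /= /eqP|[i|[[] t]] [j|[[] s]]].
- by rewrite (inj_eq inj_v) => /eqP->.
- by rewrite eq_sym (negbTE (neq_bv _ _)).
- by rewrite eq_sym (negbTE (neq_av _ _)).
- by rewrite (negbTE (neq_bv _ _)).
- by rewrite (inj_eq inj_b) => /eqP->.
- by rewrite eq_sym (negbTE (neq_ab _ _)).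
- by rewrite (negbTE (neq_av _ _)).
- by rewrite (negbTE (neq_ab _ _)).
- by rewrite (inj_eq inj_a) => /eqP->.
- rewrite [LHS]adj_v /= /gen_adj /=; have [->|ne_ij] := eqVneq i j.
    by rewrite eqxx /=; lia.
  rewrite (_ : inl i != inl j :> 'I_N.+1 + bool * bool) //.
- by rewrite adj_sym [LHS]adj_bv /= /gen_adj /= orbF.
- by rewrite adj_sym [LHS]adj_av /= /gen_adj /= orbF.
- by rewrite [LHS]adj_bv /= /gen_adj /=.
- rewrite /= /gen_adj /= andbT; have [<-|ne_ts] := eqVneq t s.
    by rewrite adj_irrefl eqxx.
  have [[b1 _] [b2 _]] := (Hb t, Hb s).
  by rewrite (clique_adj (clq N.+1 (leqnn _)) b1 b2) ?(inj_eq inj_b) //.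
- by rewrite -[LHS]/(b t -- a s) adj_sym nadj_ab.
- by rewrite [LHS]adj_av /= /gen_adj /=.
- by rewrite [LHS]nadj_ab.
- rewrite /= /gen_adj /= andbT; have [<-|ne_ts] := eqVneq t s.
    by rewrite adj_irrefl eqxx.
  have [[b1 _] [b2 _]] := (Ha t, Ha s).
  by rewrite (clique_adj (clq 0 isT) b1 b2) ?(inj_eq inj_a) //.
Qed.

(** An edge takes the colour of its hull. Edges at [x] with adjacent other ends have the same hull;
    otherwise their hulls are different cliques meeting in [x]. An edge of a triangle has a big
    hull. *)
Lemma free_good :
  (forall P, odd_hole P -> ~ embeds P G) ->
  (forall P, even_butterfly P -> ~ embeds P G) ->
  exists c : {set G} -> bool, good_colouring c.
Proof.
move=> no_hole no_butterfly.
have no_odd p n : walk meet p n -> p n = p 0 -> ~~ odd n.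
  move=> wp pn; apply/negP=> odd_n.
  have [q [m [wq qm odd_m inj_q]]] := odd_closed_walk_simple wp pn odd_n.
  by have [P /no_hole noP /noP] := odd_hole_of_closed_walk wq qm odd_m inj_q.
have [c0 proper_c0] := bipartite_of_no_odd_closed_walk meet_sym no_odd.
have big_c0 A B : big A -> big B -> connect meet A B -> c0 A = c0 B.
  move=> bigA bigB /connect_walk[p [n [wp p0 pn]]]; apply/eqP/negPn/negP => /eqP ne_c.
  have [q [m [wq q0 qm short]]] := shortest_walk wp.
  rewrite p0 in q0; rewrite pn in qm.
  rewrite -q0 in bigA ne_c; rewrite -qm in bigB ne_c.
  by have [P /no_butterfly noP /noP] := even_butterfly_of_walk proper_c0 wq bigA bigB ne_c short.
have [c [proper_c big_c]] := flip_components meet_sym proper_c0 big_c0.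
have hull_tri (x y z : G) : x -- y -> x -- z -> y -- z -> z \in hull [set x; y].
  by move=> xy xz yz; rewrite in_hull [z -- x]adj_sym [z -- y]adj_sym xz yz !orbT.
exists (fun e => c (hull e)); split=> x y z xy xz => [ne_yz|yz].
  have ne_xz := adj_neq xz.
  apply/idP/idP => [|yz]; last first.
    by rewrite (hull_eq xy (hull_l xy) (hull_tri x y z _ _ _) ne_xz).
  apply: contraTT => nyz; apply: proper_c.
  apply: (meetI (hull_clique xy) (hull_clique xz) (hull_l xy) (hull_l xz)).
  apply: contraNneq nyz => eq_h; apply: (clique_adj (hull_clique xz)) => //.
    by rewrite -eq_h hull_r.
  exact: hull_r.
apply: big_c; rewrite /big hull_clique //=; apply/card_gt2P.
exists x, y, z; rewrite hull_l // hull_r // hull_tri //.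
by rewrite !adj_neq // adj_sym.
Qed.

End CliqueGraph.

(** * The equivalences *)

Lemma good_colouring_ext (G : sgraph) (c c' : {set G} -> bool) :
  c =1 c' -> good_colouring c -> good_colouring c'.
Proof.
move=> eq_c [pair tri]; split=> x y z; rewrite -!eq_c; [exact: pair | exact: tri].
Qed.

(** The right side does not depend on [k], so (1) and (2) are equivalent to the same property. *)
Lemma admits_patterns_good k (G : sgraph) :
  admits_free_colouring (patterns k) G <->
  exists c : {set G} -> bool, good_colouring c.
Proof.
split=> [[c /patterns_free_good good_c]|[c good_c]]; first by eexists; apply: good_c.
exists (fun e => if c e then k else other k).
apply: good_patterns_free; apply: good_colouring_ext good_c => e.
by case: (c e); case: k.
Qed.

Theorem theorem16 (G : sgraph) :
  let S1 := admits_free_colouring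
              (fun P => List.In P [:: rP3; bP3; bK3; rrbK3; rbbK3]) G in
  let S2 := admits_free_colouring
              (fun P => List.In P [:: rP3; bP3; rK3; rrbK3; rbbK3]) G in
  let S3 := exists H : sgraph, incidence_graph H /\ isomorphic G (line_graph H) in
  let S4 := free (fun P => P = claw \/ P = diamond \/ odd_hole P \/ even_butterfly P) G in
  [/\ S1 <-> S2, S2 <-> S3 & S3 <-> S4].
Proof.
move=> S1 S2 S3 S4.
pose good := exists c : {set G} -> bool, good_colouring c.
(* At each colour, [patterns] unfolds to the list in the statement. *)
have g1 : S1 <-> good := admits_patterns_good Red G.
have g2 : S2 <-> good := admits_patterns_good Blue G.
have g3 : S3 <-> good.
  split=> [[H [incH isoH]]|[c good_c]]; first exact: line_incidence_good isoH.
  by exists (root_graph c); split; [apply: root_incidence | apply: root_line].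
have g4 : S4 <-> good.
  split=> [/freeP free_G|[c good_c]].
    by apply: free_good => [||P hP|P bP]; apply: free_G; tauto.
  apply/freeP => P [->|[->|[]]].
  - exact: good_no_claw good_c.
  - exact: good_no_diamond good_c.
  - exact: good_no_odd_hole good_c _.
  - exact: good_no_even_butterfly good_c _.
by split; tauto.
Qed.
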